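(* Let $p$ be a prime and let $(A,+,\cdot)$ be a pre-Lie algebra over $\mathbb{F}_p$ with $(A,+)\cong C_p^5$, generated by a single element $x$ as a pre-Lie algebra. Suppose $A^{[6]}\neq 0$, $A^{[7]}=0$ and $A^{[5]}=A^{[4]}$. Then the following hold. (1) The elements $x,\ x^2,\ x^2\cdot x,\ x^2\cdot(x^2\cdot x),\ (x^2\cdot(x^2\cdot x))\cdot x$ form a basis of $A$ as an $\mathbb{F}_p$-vector space. (2) $x\cdot x^2\in A^{[4]}$. (3) $x\cdot(x\cdot x^2),\ (x\cdot x^2)\cdot x\in A^{[6]}$. (4) $x\cdot(x\cdot(x\cdot x^2))=(x\cdot(x\cdot x^2))\cdot x=x^2\cdot(x\cdot x^2)=(x\cdot x^2)\cdot x^2=0$, and the elements $x\cdot(x\cdot(x^2\cdot x))$, $(x\cdot(x^2\cdot x))\cdot x$, $x\cdot((x^2\cdot x)\cdot x)$, $((x^2\cdot x)\cdot x)\cdot x$, $(x^2\cdot x)\cdot x^2$ all lie in $A^{[6]}$. (5) $(x^2\cdot(x^2\cdot x))\cdot x=x\cdot(x^2\cdot(x^2\cdot x))=-(x^2\cdot x)\cdot(x^2\cdot x)$. (6) $A^{[6]}=\mathbb{F}_p\,(x^2\cdot x)\cdot(x^2\cdot x)$, $A^{[5]}/A^{[6]}=\mathbb{F}_p\,x^2\cdot(x^2\cdot x)$, and $A^{[3]}/A^{[4]}=\mathbb{F}_p\,x^2\cdot x$.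
   Context: A pre-Lie algebra over $\mathbb{F}_p$ is an $\mathbb{F}_p$-vector space $A$ with a bilinear product $\cdot$ satisfying $(a\cdot b)\cdot c-a\cdot(b\cdot c)=(b\cdot a)\cdot c-b\cdot(a\cdot c)$ for all $a,b,c\in A$. For subspaces $B,C\subseteq A$, $B\cdot C$ denotes the subspace spanned by all $b\cdot c$ with $b\in B$, $c\in C$. Define $A^{[1]}=A$ and $A^{[i+1]}=\sum_{j=1}^{i}A^{[j]}\cdot A^{[i+1-j]}$ for $i\ge 1$. Write $x^2=x\cdot x$. For $a\in A$, $A^{[i]}=\mathbb{F}_p\,a$ means $A^{[i]}$ is spanned by $a$, and $A^{[i]}/A^{[j]}=\mathbb{F}_p\,a$ means the quotient is spanned by the image of $a\in A^{[i]}$. *)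

(* Defs.v *)
From HB Require Import structures.
From mathcomp Require Import all_boot all_order all_algebra.

Set Implicit Arguments.
Unset Strict Implicit.
Unset Printing Implicit Defensive.

Import GRing.Theory.
Local Open Scope ring_scope.

HB.mixin Record Vector_isPreLie (K : fieldType) A of Vector K A := {
  plmul : A -> A -> A;
  plmul_is_bilinear : bilinear_for *:%R *:%R plmul;
  plmul_assoc_sym : forall a b c : A,
    plmul (plmul a b) c - plmul a (plmul b c)
    = plmul (plmul b a) c - plmul b (plmul a c)
}.

(* Finite-dimensional (left) pre-Lie algebras over a field. *)
#[short(type="preLieType")]
HB.structure Definition PreLie (K : fieldType) :=
  { A of Vector K A & Vector_isPreLie K A }.

Reserved Notation "a *o b" (at level 40, left associativity).
Notation "a *o b" := (plmul a b) : ring_scope.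

HB.instance Definition _ (K : fieldType) (A : preLieType K) :=
  bilinear_isBilinear.Build K A A A *:%R *:%R (@plmul K A) plmul_is_bilinear.

Section PreLieTheory.

Variables (K : fieldType) (A : preLieType K).
Implicit Types (a x : A) (U V W : {vspace A}).

(* As for prodv in falgebra, it is enough to multiply elements of bases; plprodvP
   shows that this is the span of all the products. *)
Definition plprodv U V : {vspace A} :=
  <<allpairs (@plmul K A) (vbasis U) (vbasis V)>>%VS.

Lemma memv_plmul U V : {in U & V, forall u v, u *o v \in plprodv U V}.
Proof.
move=> u v /coord_vbasis-> /coord_vbasis->.
rewrite linear_sumlz; apply: memv_suml => i _.
rewrite linear_sumr; apply: memv_suml => j _.
rewrite linearZl_LR linearZr_LR !memvZ // memv_span //.
by apply/allpairsP; exists ((vbasis U)`_i, (vbasis V)`_j); rewrite !memt_nth.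
Qed.

Lemma plprodvP {U V W} :
  reflect {in U & V, forall u v, u *o v \in W} (plprodv U V <= W)%VS.
Proof.
apply: (iffP idP) => [sUVW u v Uu Vv | sUVW].
  by rewrite (subvP sUVW) ?memv_plmul.
apply/span_subvP=> _ /allpairsP[[u v] /= [Uu Vv ->]].
by rewrite sUVW ?vbasis_mem.
Qed.

(* plpows n = [:: A^[1]; ...; A^[n]]; the recursion is course-of-values, so the
   whole list is carried along. plpow1 and plpowS give the defining equations. *)
Fixpoint plpows (n : nat) : seq {vspace A} :=
  if n is m.+1 then
    let s := plpows m in
    rcons s (if m == 0%N then fullv
             else \sum_(1 <= j < m.+1) plprodv (nth 0%VS s j.-1) (nth 0%VS s (m - j)))%VS
  else [::].

(* A^[i]; the value at i = 0 is irrelevant. *)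
Definition plpow (i : nat) : {vspace A} := nth 0%VS (plpows i) i.-1.

Lemma size_plpows n : size (plpows n) = n.
Proof. by elim: n => //= n IHn; rewrite size_rcons IHn. Qed.

Lemma nth_plpows n i : (i < n)%N -> nth 0%VS (plpows n) i = plpow i.+1.
Proof.
elim: n => // n IHn; rewrite ltnS leq_eqVlt => /predU1P[->//|lt_in].
by rewrite /= nth_rcons size_plpows lt_in IHn.
Qed.

Lemma plpow1 : plpow 1 = fullv.
Proof. by []. Qed.

Lemma plpowS i : (0 < i)%N ->
  plpow i.+1 = (\sum_(1 <= j < i.+1) plprodv (plpow j) (plpow (i.+1 - j)))%VS.
Proof.
move=> i_gt0; rewrite {1}/plpow /= nth_rcons size_plpows ltnn eqxx.
rewrite -[i == 0%N]negbK -lt0n i_gt0 /=.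
apply: eq_big_nat => j /andP[j_gt0 le_ji].
rewrite !nth_plpows ?prednK ?subSn //.
by rewrite ltn_subrL j_gt0 i_gt0.
Qed.

(* No proper subalgebra of A contains x. *)
Definition pl_generated_by x : Prop :=
  forall U : {vspace A},
    x \in U -> {in U &, forall u v, u *o v \in U} -> U = fullv.

(* U / V is spanned by the image of a \in U. *)
Definition quot_spanned_by U V a : Prop :=
  [/\ (V <= U)%VS, a \in U
    & {in U, forall u, exists c : K, u - c *: a \in V}].

End PreLieTheory.

(* Main.v *)
Require Import Defs.
From HB Require Import structures.
From mathcomp Require Import all_boot all_order all_algebra.

Set Implicit Arguments.
Unset Strict Implicit.
Unset Printing Implicit Defensive.

Import GRing.Theory.
Local Open Scope ring_scope.

(** Write A_i for A^[i], y = x x^2, z = x^2 x and u = x^2 z.  The A_i form a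
descending filtration with A_i A_j <= A_{i+j}, and since x generates A, the
quotient A_i / A_{i+1} is spanned by the products of i factors x: one needs x
for i = 1, x^2 for i = 2, and y, z for i = 3.

The hypothesis A_4 = A_5 shifts weights: every product of four factors x
already has weight 5.  Hence A_1 A_4 and A_4 A_1 lie in A_6, while A_2 A_4 and
A_4 A_2 lie in A_7 = 0.  In each instance of the pre-Lie identity in weights 5
and 6, most of the terms are therefore negligible, and what survives is
- in weight 5, modulo A_6: y x^2, z x^2 and x^2 y vanish, so u spans A_5 / A_6;
- in weight 6: y z = z y = y y = 0 and u x = x u = - z z, so z z spans A_6.
All coefficients in these identities are 1 or -1, so the argument is independent
of the characteristic.

Now A_6 <> 0 gives z z <> 0, and going backwards along the products leading from
x to z z, u is not in A_6, z is not in A_4, x^2 is not in A_3 and x is not in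
A_2.  If y were not in F z + A_4, then
  0 < A_6 < A_4 < F z + A_4 < A_3 < A_2 < A
would be a chain with six strict steps, which is impossible in dimension 5.  So
y = c z + a with a in A_4, and multiplying by x^2 on the left gives
c u = x^2 y in A_6, whence c = 0 and y is in A_4.  The remaining claims
follow from this membership, the weight shift and the identities above, and the
filtration gives the basis x, x^2, z, u, u x. *)

(** * The filtration of a pre-Lie algebra by its powers *)

Section PreLieFiltration.

Variables (K : fieldType) (A : preLieType K).
Implicit Types (a b u v x : A) (U V W : {vspace A}) (i j : nat).

Lemma plmul0l v : 0 *o v = 0 :> A.
Proof. exact: linear0l. Qed.

Lemma plmul0r v : v *o 0 = 0 :> A.
Proof. exact: linear0r. Qed.

Lemma plprodvDl U V W : plprodv (U + V) W = (plprodv U W + plprodv V W)%VS.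
Proof.
apply/eqP; rewrite eqEsubv; apply/andP; split.
  apply/plprodvP => _ w /memv_addP[u Uu [v Vv ->]] Ww.
  by rewrite linearDl memv_add ?memv_plmul.
rewrite subv_add; apply/andP; split; apply/plprodvP => u w Uu Ww;
  by rewrite memv_plmul // (subvP _ _ Uu) ?addvSl ?addvSr.
Qed.

Lemma plprodvDr U V W : plprodv W (U + V) = (plprodv W U + plprodv W V)%VS.
Proof.
apply/eqP; rewrite eqEsubv; apply/andP; split.
  apply/plprodvP => w _ Ww /memv_addP[u Uu [v Vv ->]].
  by rewrite linearDr memv_add ?memv_plmul.
rewrite subv_add; apply/andP; split; apply/plprodvP => w u Ww Uu;
  by rewrite memv_plmul // (subvP _ _ Uu) ?addvSl ?addvSr.
Qed.

Lemma plprodv_line a b : plprodv <[a]> <[b]> = <[a *o b]>%VS.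
Proof.
apply/eqP; rewrite eqEsubv -[(<[_]> <= plprodv _ _)%VS]memvE.
rewrite memv_plmul ?memv_line // andbT.
apply/plprodvP => _ _ /vlineP[c ->] /vlineP[d ->].
by rewrite linearZl_LR linearZr_LR !memvZ ?memv_line.
Qed.

Lemma plpow0 : plpow A 0 = 0%VS.
Proof. by []. Qed.

Lemma memv_plpow1 u : u \in plpow A 1.
Proof. by rewrite plpow1 memvf. Qed.

(** In this encoding A^[0] is the zero subspace, so the inclusion holds for all i
and j, and unification alone finds the weights when the lemma is applied. *)
Lemma memv_plpowM i j u v :
  u \in plpow A i -> v \in plpow A j -> u *o v \in plpow A (i + j).
Proof.
case: i => [|i]; first by rewrite plpow0 memv0 => /eqP->; rewrite plmul0l mem0v.
case: j => [|j Au Av].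
  by rewrite plpow0 memv0 => _ /eqP->; rewrite plmul0r mem0v.
rewrite addSn plpowS; last by rewrite addnS.
rewrite (bigD1_seq i.+1) ?iota_uniq //=; last first.
  by rewrite mem_index_iota /= addnS !ltnS leq_addr.
rewrite subSS addKn.
exact: (subvP (addvSl _ _)) (memv_plmul Au Av).
Qed.

Lemma plpowS_subP i W : (0 < i)%N ->
  (forall j, (0 < j <= i)%N -> (plprodv (plpow A j) (plpow A (i.+1 - j)) <= W)%VS) ->
  (plpow A i.+1 <= W)%VS.
Proof.
move=> i_gt0 sW; rewrite plpowS // big_nat_cond.
elim/big_ind: _ => [|U V sU sV|j /andP[lt_ji _]]; first exact: sub0v.
  by rewrite subv_add sU.
exact: sW.
Qed.

Lemma plpowS_sub i : (0 < i)%N -> (plpow A i.+1 <= plpow A i)%VS.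
Proof.
elim/ltn_ind: i => -[//|[|i]] IH _; first by rewrite plpow1 subvf.
apply: plpowS_subP => // -[//|[|j]] /andP[_ le_ji]; apply/plprodvP => u v Au Av.
  by rewrite (memv_plpowM (i := 1) (j := i.+1)) // (subvP (IH i.+1 _ _)).
rewrite [i.+2](_ : _ = j.+1 + (i.+3 - j.+2))%N; last first.
  by rewrite !subSS addSn subnKC // -ltnS -ltnS ltnW.
by rewrite memv_plpowM // (subvP (IH j.+1 _ _)).
Qed.

Lemma plpow_sub i j : (0 < i)%N -> (i <= j)%N -> (plpow A j <= plpow A i)%VS.
Proof.
move=> i_gt0 /subnKC<-; elim: (j - i)%N => [|k IHk]; first by rewrite addn0.
by rewrite addnS (subv_trans (plpowS_sub _)) // addn_gt0 i_gt0.
Qed.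

(** The leading part of a product depends only on the leading parts of its
factors.  This is how spanning sets of A^[i] / A^[i+1] are propagated from low
weights to high ones. *)
Lemma plprodv_plpow_sub i j U V : (0 < i)%N -> (0 < j)%N ->
    (U <= plpow A i)%VS ->
    (plpow A i <= U + plpow A i.+1)%VS -> (plpow A j <= V + plpow A j.+1)%VS ->
  (plprodv (plpow A i) (plpow A j) <= plprodv U V + plpow A (i + j).+1)%VS.
Proof.
move=> i_gt0 j_gt0 sUA sAU sAV; apply/plprodvP => u v Au Av.
have /memv_addP[u1 Uu1 [u2 Au2 ->]] := subvP sAU _ Au.
have /memv_addP[v1 Vv1 [v2 Av2 def_v]] := subvP sAV _ Av.
(* Expanding v only next to u1 leaves u1 v2 and u2 v, both of weight > i + j. *)
rewrite linearDl {1}def_v linearDr -addrA memv_add ?memv_plmul //.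
apply: memvD; last exact: (memv_plpowM (i := i.+1)).
by rewrite -addnS memv_plpowM // (subvP sUA).
Qed.

Lemma ltn_dimv U V v : (U <= V)%VS -> v \in V -> v \notin U -> (\dim U < \dim V)%N.
Proof.
move=> sUV Vv; apply: contraR; rewrite -leqNgt => leVU.
have /eqP-> : U == V by rewrite eqEdim sUV.
exact: Vv.
Qed.

Lemma quot_spanned_by_line U V a :
  (V <= U)%VS -> a \in U -> (U <= <[a]> + V)%VS -> quot_spanned_by U V a.
Proof.
move=> sVU Ua sU; split=> // _ /(subvP sU)/memv_addP[_ /vlineP[c ->] [v Vv ->]].
by exists c; rewrite addrC addKr.
Qed.

(** The right-hand side is a subalgebra containing x: every product lies in
A^[2]. *)
Lemma plpow1_gen x : pl_generated_by x -> plpow A 1 = (<[x]> + plpow A 2)%VS.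
Proof.
move=> x_gen; rewrite plpow1; apply/esym/x_gen.
  by rewrite (subvP (addvSl _ _)) ?memv_line.
move=> u v _ _; rewrite (subvP (addvSr _ _)) //.
exact: (memv_plpowM (i := 1) (j := 1) (memv_plpow1 u) (memv_plpow1 v)).
Qed.

Lemma plpow2_gen x : pl_generated_by x ->
  (plpow A 2 <= <[x *o x]> + plpow A 3)%VS.
Proof.
move=> /plpow1_gen gen1; apply: plpowS_subP => // -[|[|//]] // _.
rewrite -plprodv_line.
by apply: (@plprodv_plpow_sub 1 1); rewrite -?gen1 ?plpow1 ?subvf.
Qed.

Lemma plpow3_gen x : pl_generated_by x ->
  (plpow A 3 <= <[x *o (x *o x)]> + <[x *o x *o x]> + plpow A 4)%VS.
Proof.
move=> x_gen; have gen1 := plpow1_gen x_gen; have gen2 := plpow2_gen x_gen.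
have sx2 : (<[(x *o x : A)]> <= plpow A 2)%VS.
  by rewrite -memvE (memv_plpowM (i := 1) (j := 1)) ?memv_plpow1.
have sx1 : (<[x]> <= plpow A 1)%VS by rewrite plpow1 subvf.
have sA1 : (plpow A 1 <= <[x]> + plpow A 2)%VS by rewrite -gen1.
rewrite -(plprodv_line x) -(plprodv_line (x *o x)).
apply: plpowS_subP => // -[|[|[|//]]] // _.
  apply: subv_trans (@plprodv_plpow_sub 1 2 _ _ _ _ sx1 sA1 gen2) _ => //.
  by rewrite addvS // addvSl.
apply: subv_trans (@plprodv_plpow_sub 2 1 _ _ _ _ sx2 gen2 sA1) _ => //.
by rewrite addvS // addvSr.
Qed.

End PreLieFiltration.

(** * Single generator, A^[7] = 0 and A^[5] = A^[4] *)

Section FiveDimensional.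

Variables (K : fieldType) (A : preLieType K) (x : A).
Hypotheses (dimA : \dim {:A} = 5%N) (x_gen : pl_generated_by x).
Hypotheses (A6_neq0 : plpow A 6 <> 0%VS) (A7_eq0 : plpow A 7 = 0%VS).
Hypothesis A5_eq_A4 : plpow A 5 = plpow A 4.

Let x2 := x *o x.
Let y := x *o x2.
Let z := x2 *o x.
Let u := x2 *o z.

Lemma plpow4_plpow5 v : v \in plpow A 4 -> v \in plpow A 5.
Proof. by rewrite A5_eq_A4. Qed.

Lemma plmul_eq0 i j a b : (7 <= i + j)%N ->
  a \in plpow A i -> b \in plpow A j -> a *o b = 0.
Proof.
move=> le7 Aa Ab; apply/eqP; rewrite -memv0 -A7_eq0.
by rewrite (subvP (plpow_sub A (ltn0Sn 6) le7)) ?memv_plpowM.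
Qed.

Let x_in : x \in plpow A 1. Proof. exact: memv_plpow1. Qed.
Let x2_in : x2 \in plpow A 2. Proof. exact: (memv_plpowM x_in x_in). Qed.
Let y_in : y \in plpow A 3. Proof. exact: (memv_plpowM x_in x2_in). Qed.
Let z_in : z \in plpow A 3. Proof. exact: (memv_plpowM x2_in x_in). Qed.
Let xz_in : x *o z \in plpow A 5.
Proof. exact: plpow4_plpow5 (memv_plpowM x_in z_in). Qed.
Let zx_in : z *o x \in plpow A 5.
Proof. exact: plpow4_plpow5 (memv_plpowM z_in x_in). Qed.
Let xy_in : x *o y \in plpow A 5.
Proof. exact: plpow4_plpow5 (memv_plpowM x_in y_in). Qed.
Let yx_in : y *o x \in plpow A 5.
Proof. exact: plpow4_plpow5 (memv_plpowM y_in x_in). Qed.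
Let x2x2_in : x2 *o x2 \in plpow A 5.
Proof. exact: plpow4_plpow5 (memv_plpowM x2_in x2_in). Qed.
Let u_in : u \in plpow A 5. Proof. exact: (memv_plpowM x2_in z_in). Qed.

Let mulx5 v : v \in plpow A 5 -> x *o v \in plpow A 6.
Proof. exact: (memv_plpowM x_in). Qed.
Let mul5x v : v \in plpow A 5 -> v *o x \in plpow A 6.
Proof. by move=> Av; exact: (memv_plpowM Av x_in). Qed.

(** In this lemma and the next two, the pre-Lie identity is used in weight 5:
the terms x w and w x, where w is a product of four factors, fall into A^[6], and
so does every other term but one. *)
Lemma plmul_y_x2 : y *o x2 \in plpow A 6.
Proof.
have E := plmul_assoc_sym x y x; rewrite -/x2 in E.
have -> : y *o x2 = y *o x *o x - (x *o y *o x - x *o (y *o x)).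
  by rewrite E subKr.
by rewrite !rpredB ?mulx5 ?mul5x.
Qed.

Lemma plmul_z_x2 : z *o x2 \in plpow A 6.
Proof.
have E := plmul_assoc_sym x z x; rewrite -/x2 in E.
have -> : z *o x2 = z *o x *o x - (x *o z *o x - x *o (z *o x)).
  by rewrite E subKr.
by rewrite !rpredB ?mulx5 ?mul5x.
Qed.

Lemma plmul_x2_y : x2 *o y \in plpow A 6.
Proof.
have E := plmul_assoc_sym x x2 x2; rewrite -/y -/z in E.
have -> : x2 *o y = z *o x2 - (y *o x2 - x *o (x2 *o x2)).
  by rewrite E subKr.
by rewrite !rpredB ?mulx5 ?plmul_z_x2 ?plmul_y_x2.
Qed.

(** From here to the vanishing of y y, the pre-Lie identity is used in weight 6,
where A^[2] A^[4] = A^[4] A^[2] = 0 and where the products of five factors that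
lie in A^[6] contribute nothing. *)
Lemma plmul_u_x : u *o x = - (z *o z).
Proof.
have E := plmul_assoc_sym x2 z x; rewrite -/z -/u in E.
have E1 : x2 *o (z *o x) = 0 by exact: plmul_eq0 x2_in zx_in.
have E2 : z *o x2 *o x = 0 by exact: plmul_eq0 plmul_z_x2 x_in.
by rewrite E1 E2 subr0 sub0r in E.
Qed.

Lemma plmul_y_z : y *o z = 0.
Proof.
have E := plmul_assoc_sym x2 y x; rewrite -/z in E.
have E1 : x2 *o y *o x = 0 by exact: plmul_eq0 plmul_x2_y x_in.
have E2 : x2 *o (y *o x) = 0 by exact: plmul_eq0 x2_in yx_in.
have E3 : y *o x2 *o x = 0 by exact: plmul_eq0 plmul_y_x2 x_in.
by rewrite E1 E2 E3 !sub0r oppr0 in E; apply/eqP; rewrite -oppr_eq0 -E.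
Qed.

Lemma plmul_x_u : x *o u = - (z *o z).
Proof.
have E := plmul_assoc_sym x x2 z; rewrite -/y -/z -/u in E.
have E1 : x2 *o (x *o z) = 0 by exact: plmul_eq0 x2_in xz_in.
by rewrite E1 plmul_y_z sub0r subr0 in E; rewrite -E opprK.
Qed.

Lemma plmul_z_y : z *o y = 0.
Proof.
have E := plmul_assoc_sym x z x2; rewrite -/y in E.
have E1 : x *o z *o x2 = 0 by exact: plmul_eq0 xz_in x2_in.
have E2 : x *o (z *o x2) = 0 by exact: plmul_eq0 x_in plmul_z_x2.
have E3 : z *o x *o x2 = 0 by exact: plmul_eq0 zx_in x2_in.
by rewrite E1 E2 E3 !sub0r oppr0 in E; apply/eqP; rewrite -oppr_eq0 -E.
Qed.

Lemma plmul_y_y : y *o y = 0.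
Proof.
have E := plmul_assoc_sym x x2 y; rewrite -/y -/z in E.
have E1 : x *o (x2 *o y) = 0 by exact: plmul_eq0 x_in plmul_x2_y.
have E2 : x2 *o (x *o y) = 0 by exact: plmul_eq0 x2_in xy_in.
by rewrite E1 E2 plmul_z_y !subr0 in E.
Qed.

Let gen1 : plpow A 1 = (<[x]> + plpow A 2)%VS. Proof. exact: plpow1_gen. Qed.
Let gen2 : (plpow A 2 <= <[x2]> + plpow A 3)%VS. Proof. exact: plpow2_gen. Qed.
Let gen3 : (plpow A 3 <= <[y]> + <[z]> + plpow A 4)%VS.
Proof. exact: plpow3_gen. Qed.

Let x2_sub : (<[x2]> <= plpow A 2)%VS. Proof. by rewrite -memvE. Qed.
Let yz_sub : (<[y]> + <[z]> <= plpow A 3)%VS.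
Proof. by rewrite subv_add -!memvE y_in. Qed.

Lemma plpow5_gen : (plpow A 5 <= <[u]> + plpow A 6)%VS.
Proof.
apply: plpowS_subP => // -[|[|[|[|[|//]]]]] // _.
(* In the first and last products, the factor in A^[4] is moved to A^[5]. *)
- rewrite -A5_eq_A4; apply/plprodvP => a b _ Ab.
  rewrite (subvP (addvSr _ _)) //.
  exact: (memv_plpowM (memv_plpow1 a) Ab).
- apply: subv_trans (@plprodv_plpow_sub _ _ 2 3 _ _ _ _ x2_sub gen2 gen3) _ => //.
  rewrite plprodvDr !plprodv_line !subv_add addvSr addvSl !andbT.
  by rewrite -memvE (subvP (addvSr _ _)) // plmul_x2_y.
- apply: subv_trans (@plprodv_plpow_sub _ _ 3 2 _ _ _ _ yz_sub gen3 gen2) _ => //.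
  rewrite plprodvDl !plprodv_line !subv_add addvSr andbT -!memvE.
  by rewrite !(subvP (addvSr _ _)) ?plmul_y_x2 ?plmul_z_x2.
- rewrite -A5_eq_A4; apply/plprodvP => a b Aa _.
  rewrite (subvP (addvSr _ _)) //.
  exact: (memv_plpowM Aa (memv_plpow1 b)).
Qed.

Lemma plpow6_line : plpow A 6 = <[z *o z]>%VS.
Proof.
apply/eqP; rewrite eqEsubv -[(<[_]> <= plpow A 6)%VS]memvE.
rewrite (memv_plpowM z_in z_in) andbT.
rewrite -[<[_]>%VS]addv0 -A7_eq0.
have sx1 : (<[x]> <= plpow A 1)%VS by rewrite -memvE.
have sA1 : (plpow A 1 <= <[x]> + plpow A 2)%VS by rewrite -gen1.
have su : (<[u]> <= plpow A 5)%VS by rewrite -memvE.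
apply: plpowS_subP => // -[|[|[|[|[|[|//]]]]]] // _.
- apply: subv_trans (@plprodv_plpow_sub _ _ 1 5 _ _ _ _ sx1 sA1 plpow5_gen) _ => //.
  rewrite plprodv_line plmul_x_u subv_add addvSr andbT -memvE.
  by rewrite rpredN (subvP (addvSl _ _)) ?memv_line.
- rewrite -A5_eq_A4; apply/plprodvP => a b Aa Ab.
  by rewrite (plmul_eq0 _ Aa Ab) ?mem0v.
- apply: subv_trans (@plprodv_plpow_sub _ _ 3 3 _ _ _ _ yz_sub gen3 gen3) _ => //.
  rewrite plprodvDl !plprodvDr !plprodv_line plmul_y_y plmul_y_z plmul_z_y.
  by rewrite !subv_add addvSl addvSr -!memvE !mem0v.
- rewrite -A5_eq_A4; apply/plprodvP => a b Aa Ab.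
  by rewrite (plmul_eq0 _ Aa Ab) ?mem0v.
- apply: subv_trans (@plprodv_plpow_sub _ _ 5 1 _ _ _ _ su plpow5_gen sA1) _ => //.
  rewrite plprodv_line plmul_u_x subv_add addvSr andbT -memvE.
  by rewrite rpredN (subvP (addvSl _ _)) ?memv_line.
Qed.

Lemma plmul_zz_neq0 : z *o z != 0.
Proof.
apply/eqP => zz0; apply: A6_neq0; apply/eqP.
by rewrite plpow6_line zz0 -subv0 -memvE mem0v.
Qed.

(** This lemma and the next three climb back from z z <> 0: if a generator of
some weight had a larger weight, then so would the products leading from it to
u and to u x = - z z, and z z would lie in A^[7] = 0. *)
Lemma u_notin_plpow6 : u \notin plpow A 6.
Proof.
apply: contra plmul_zz_neq0 => Au.
by rewrite -oppr_eq0 -plmul_u_x (plmul_eq0 _ Au x_in).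
Qed.

Lemma z_notin_plpow4 : z \notin plpow A 4.
Proof.
apply: contra u_notin_plpow6 => /plpow4_plpow5 Az.
by rewrite [u](plmul_eq0 _ x2_in Az) ?mem0v.
Qed.

Lemma x2_notin_plpow3 : x2 \notin plpow A 3.
Proof.
apply: contra u_notin_plpow6 => Ax2; exact: (memv_plpowM Ax2 z_in).
Qed.

Lemma x_notin_plpow2 : x \notin plpow A 2.
Proof.
apply: contra plmul_zz_neq0 => Ax.
by rewrite -oppr_eq0 -plmul_u_x (plmul_eq0 _ u_in Ax).
Qed.

(** Otherwise the chain 0 < A^[6] < A^[4] < <[z]> + A^[4] < A^[3] < A^[2] < A
would be strict, exceeding the dimension. *)
Lemma y_in_z_plpow4 : y \in (<[z]> + plpow A 4)%VS.
Proof.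
apply: contraT => y_notin.
have d6 : (0 < \dim (plpow A 6))%N by rewrite lt0n dimv_eq0; apply/eqP.
have d4 : (\dim (plpow A 6) < \dim (plpow A 4))%N.
  by rewrite -A5_eq_A4 (ltn_dimv _ u_in u_notin_plpow6) ?plpowS_sub.
have d34 : (\dim (plpow A 4) < \dim (<[z]> + plpow A 4))%N.
  apply: ltn_dimv z_notin_plpow4; first exact: addvSr.
  by rewrite (subvP (addvSl _ _)) ?memv_line.
have d3 : (\dim (<[z]> + plpow A 4) < \dim (plpow A 3))%N.
  by rewrite (ltn_dimv _ y_in y_notin) // subv_add -memvE z_in plpowS_sub.
have d2 : (\dim (plpow A 3) < \dim (plpow A 2))%N.
  by rewrite (ltn_dimv _ x2_in x2_notin_plpow3) ?plpowS_sub.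
have d1 : (\dim (plpow A 2) < 5)%N.
  by rewrite -dimA -plpow1 (ltn_dimv _ x_in x_notin_plpow2) ?plpowS_sub.
by move/(leq_ltn_trans d6)/leq_ltn_trans/(_ d34)/leq_ltn_trans/(_ d3): d4
  => /leq_ltn_trans/(_ d2)/leq_ltn_trans/(_ d1).
Qed.

(** Left multiplication by x^2 detects the coefficient of z: it kills A^[4] and
sends z to u, which is not in A^[6], whereas x^2 y is in A^[6]. *)
Lemma y_in_plpow4 : y \in plpow A 4.
Proof.
have /memv_addP[_ /vlineP[c ->] [a Aa def_y]] := y_in_z_plpow4.
have : c *: u \in plpow A 6.
  suff <- : x2 *o y = c *: u by exact: plmul_x2_y.
  rewrite def_y linearDr linearZr_LR /=.
  by rewrite (plmul_eq0 _ x2_in (plpow4_plpow5 Aa)) // addr0.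
rewrite rpredZeq (negPf u_notin_plpow6) orbF => /eqP c0.
by rewrite def_y c0 scale0r add0r.
Qed.

Lemma plpow3_gen_z : (plpow A 3 <= <[z]> + plpow A 4)%VS.
Proof.
by rewrite (subv_trans gen3) // !subv_add addvSl addvSr -memvE y_in_z_plpow4.
Qed.

Lemma monomial_basis : basis_of fullv [:: x; x2; z; u; u *o x].
Proof.
rewrite basisEdim dimA !span_cons span_nil addv0 -plpow1 gen1 andbT.
rewrite addvS ?subvv // (subv_trans gen2) // addvS ?subvv //.
rewrite (subv_trans plpow3_gen_z) // addvS ?subvv // -A5_eq_A4.
rewrite (subv_trans plpow5_gen) // addvS ?subvv // plpow6_line plmul_u_x.
by rewrite -memvE -rpredN memv_line.
Qed.

End FiveDimensional.

(** * Dimension over a prime field *)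

(** Scalars of 'F_p are multiples of 1, so additive maps are linear. *)
Lemma dim_additive_rV p n (V : vectType 'F_p) :
  (exists f : {additive V -> 'rV['F_p]_n}, bijective f) -> \dim {:V} = n.
Proof.
case=> f [f' fK f'K].
have f_lin : linear f.
  by move=> c u v; rewrite raddfD -[c]natr_Zp !scaler_nat raddfMn.
pose fL := GRing.isLinear.Build _ _ _ _ (f : V -> _) f_lin.
pose g : {linear V -> 'rV['F_p]_n} := HB.pack (f : V -> _) fL.
have ker_g : lker (linfun g) = 0%VS.
  by apply/eqP/lker0P => u v; rewrite !lfunE; apply: can_inj fK _ _.
have <- : \dim (linfun g @: fullv) = \dim {:V}.
  by rewrite limg_dim_eq // ker_g capv0.
suff -> : (linfun g @: fullv = fullv)%VS by rewrite dimvf /dim /= mul1n.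
apply/eqP; rewrite eqEsubv subvf; apply/subvP => w _.
by apply/memv_imgP; exists (f' w); rewrite ?memvf // lfunE /= f'K.
Qed.

Theorem theorem4p2p4 (p : nat) (p_pr : prime p) (A : preLieType 'F_p)
    (A_C5 : exists f : {additive A -> 'rV['F_p]_5}, bijective f)
    (x : A) (x_gen : pl_generated_by x)
    (A6_neq0 : plpow A 6 <> 0%VS) (A7_eq0 : plpow A 7 = 0%VS)
    (A5_eq_A4 : plpow A 5 = plpow A 4) :
  let x2 := x *o x in
  (* (1) *)
  basis_of fullv [:: x; x2; x2 *o x; x2 *o (x2 *o x); (x2 *o (x2 *o x)) *o x]
  /\
  (* (2) *)
  x *o x2 \in plpow A 4
  /\
  (* (3) *)
  (x *o (x *o x2) \in plpow A 6 /\ (x *o x2) *o x \in plpow A 6)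
  /\
  (* (4) *)
  ([/\ x *o (x *o (x *o x2)) = 0, (x *o (x *o x2)) *o x = 0,
       x2 *o (x *o x2) = 0 & (x *o x2) *o x2 = 0]
   /\ [/\ x *o (x *o (x2 *o x)) \in plpow A 6,
          (x *o (x2 *o x)) *o x \in plpow A 6,
          x *o ((x2 *o x) *o x) \in plpow A 6,
          ((x2 *o x) *o x) *o x \in plpow A 6
        & (x2 *o x) *o x2 \in plpow A 6])
  /\
  (* (5) *)
  ((x2 *o (x2 *o x)) *o x = x *o (x2 *o (x2 *o x))
   /\ x *o (x2 *o (x2 *o x)) = - ((x2 *o x) *o (x2 *o x)))
  /\
  (* (6) *)
  [/\ plpow A 6 = <[(x2 *o x) *o (x2 *o x)]>%VS,
      quot_spanned_by (plpow A 5) (plpow A 6) (x2 *o (x2 *o x))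
    & quot_spanned_by (plpow A 3) (plpow A 4) (x2 *o x)].
Proof.
have dimA := dim_additive_rV A_C5.
have M i j a b := @memv_plpowM _ A i j a b.
have x_in : x \in plpow A 1 by exact: memv_plpow1.
have sh a := @plpow4_plpow5 _ A A5_eq_A4 a.
have ann i j a b := @plmul_eq0 _ A A7_eq0 i j a b.
have ux := plmul_u_x x A7_eq0 A5_eq_A4.
have xu := plmul_x_u x A7_eq0 A5_eq_A4.
have y_in := y_in_plpow4 dimA x_gen A6_neq0 A7_eq0 A5_eq_A4.
move=> x2; rewrite -/x2 in ux xu y_in.
have x2_in : x2 \in plpow A 2 := M _ _ _ _ x_in x_in.
have z_in : x2 *o x \in plpow A 3 := M _ _ _ _ x2_in x_in.
have xy_in : x *o (x *o x2) \in plpow A 6 := M _ _ _ _ x_in (sh _ y_in).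
have yx_in : x *o x2 *o x \in plpow A 6 := M _ _ _ _ (sh _ y_in) x_in.
have xz_in : x *o (x2 *o x) \in plpow A 5 := sh _ (M _ _ _ _ x_in z_in).
have zx_in : x2 *o x *o x \in plpow A 5 := sh _ (M _ _ _ _ z_in x_in).
have zx2_in : x2 *o x *o x2 \in plpow A 6 := plmul_z_x2 x A5_eq_A4.
split; first exact: monomial_basis.
split; first exact: y_in.
split; first by split.
split.
  split.
    split.
    - exact: ann x_in xy_in.
    - exact: ann xy_in x_in.
    - exact: ann x2_in (sh _ y_in).
    - exact: ann (sh _ y_in) x2_in.
  split.
  - exact: M x_in xz_in.
  - exact: M xz_in x_in.
  - exact: M x_in zx_in.
  - exact: M zx_in x_in.
  - exact: zx2_in.
split; first by rewrite ux xu.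
split; first exact: plpow6_line.
- apply: quot_spanned_by_line; first exact: plpowS_sub.
    exact: M x2_in z_in.
  exact: plpow5_gen.
- apply: quot_spanned_by_line; first exact: plpowS_sub.
    exact: z_in.
  exact: plpow3_gen_z.
Qed.
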